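(* Let $f:\mathbb{R}^n\to\mathbb{R}$ be a piecewise-affine function with abs-normal form data $s,c,b,Z,L,J,Y$ (with $m=1$), and let $\tilde L,\tilde Y,\tilde Z,\tilde J$ be the associated auxiliary matrices. The function $f$ has a global minimum in $\mathbb{R}^n$ if and only if there is no solution $(\xi,\omega)\in\mathbb{R}^n\times\mathbb{R}^s$ of the mixed linear complementarity problem $$0=1+\tilde J\xi+\tilde Y\omega,\qquad 0\le\omega\perp\tilde Z\xi+\tilde L\omega\ge 0.$$
   Context: A function $f:\mathbb{R}^n\to\mathbb{R}^m$ is piecewise affine if it is continuous and its values are chosen from finitely many affine functions, i.e. there are finitely many affine maps $f^1,\dots,f^k$ with $f(x)\in\{f^1(x),\dots,f^k(x)\}$ for every $x$. A global minimum of $f$ is a point $x^\ast$ with $f(x^\ast)\le f(x)$ for all $x\in\mathbb{R}^n$. For a vector $z$, $|z|$ denotes the componentwise absolute value; vector inequalities are componentwise. For vectors $p,q$ of the same size, $0\le p\perp q\ge 0$ means $p\ge0$, $q\ge0$ and $p^{T}q=0$. Abs-normal form: $f$ has abs-normal form data consisting of $s\in\mathbb{N}$, matrices $Z\in\mathbb{R}^{s\times n}$, $J\in\mathbb{R}^{m\times n}$, $Y\in\mathbb{R}^{m\times s}$, a strictly lower triangular matrix $L\in\mathbb{R}^{s\times s}$, and vectors $c\in\mathbb{R}^s$, $b\in\mathbb{R}^m$, if for every $x\in\mathbb{R}^n$ the unique vector $z\in\mathbb{R}^s$ with $z=c+Zx+L|z|$ satisfies $f(x)=b+Jx+Y|z|$.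 Here $m=1$. Auxiliary quantities: $\tilde L:=(I-L)^{-1}(I+L)$, $\tilde Y:=Y(I+\tilde L)$, $\tilde Z:=(I-L)^{-1}Z$, $\tilde J:=J+Y\tilde Z$. ($I-L$ is unit lower triangular, hence invertible.) *)

(* Defs.v *)
From mathcomp Require Import all_boot all_order all_algebra.
From mathcomp Require Import all_classical reals topology normedtype.
Set Implicit Arguments.
Unset Strict Implicit.
Unset Printing Implicit Defensive.
Import Order.TTheory GRing.Theory Num.Theory numFieldNormedType.Exports.
Local Open Scope ring_scope.

Definition piecewise_affine (R : realType) (n m : nat)
    (f : 'cV[R]_n -> 'cV[R]_m) : Prop :=
  continuous f /\
  exists (k : nat) (A : 'I_k -> 'M[R]_(m, n)) (d : 'I_k -> 'cV[R]_m),
    forall x, exists i : 'I_k, f x = A i *m x + d i.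

Definition is_global_min (R : realType) (n : nat)
    (f : 'cV[R]_n -> R) (x0 : 'cV[R]_n) : Prop :=
  forall x, f x0 <= f x.

Definition absv (R : realType) (s : nat) (z : 'cV[R]_s) : 'cV[R]_s :=
  map_mx Num.norm z.

Definition strictly_lower (R : realType) (s : nat) (L : 'M[R]_s) : Prop :=
  forall i j : 'I_s, (i <= j)%N -> L i j = 0.

Definition switching_eq (R : realType) (n s : nat) (c : 'cV[R]_s)
    (Z : 'M[R]_(s, n)) (L : 'M[R]_s) (x : 'cV[R]_n) (z : 'cV[R]_s) : Prop :=
  z = c + Z *m x + L *m absv z.

Lemma switching_eq_exists_unique (R : realType) (n s : nat) (c : 'cV[R]_s)
    (Z : 'M[R]_(s, n)) (L : 'M[R]_s) (x : 'cV[R]_n) :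
  strictly_lower L -> exists! z, switching_eq c Z L x z.
Proof.
move=> HL; pose T z := c + Z *m x + L *m absv z.
have contr k (z1 z2 : 'cV[R]_s) : (forall i : 'I_s, (i < k)%N -> z1 i 0 = z2 i 0) ->
    forall i : 'I_s, (i < k.+1)%N -> T z1 i 0 = T z2 i 0.
  move=> eqz i ik; rewrite /T !mxE; congr (_ + _); apply: eq_bigr => j _.
  case: (leqP i j) => [ij|ji]; first by rewrite HL // !mul0r.
  by rewrite !mxE eqz //; apply: leq_trans ji _.
have iterT k (z1 z2 : 'cV[R]_s) : forall i : 'I_s, (i < k)%N ->
    iter k T z1 i 0 = iter k T z2 i 0.
  by elim: k => // k IHk i; rewrite !iterS; apply: contr.
have iterE (z1 z2 : 'cV[R]_s) : iter s T z1 = iter s T z2.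
  by apply/colP => i; apply: iterT.
exists (iter s T 0); split.
  by rewrite /switching_eq -/(T _) -iterS iterSr; apply: iterE.
move=> z zT; rewrite (iterE _ z).
have {}zT : T z = z by rewrite [RHS]zT.
by elim: (s in iter s) => //= k ->.
Qed.

Lemma strictly_lower_unitmx (R : realType) (s : nat) (L : 'M[R]_s) :
  strictly_lower L -> 1%:M - L \in unitmx.
Proof.
move=> HL; rewrite unitmxE det_trig.
  rewrite big1 ?unitr1 // => i _.
  by rewrite !mxE eqxx HL // subr0.
apply/is_trig_mxP => i j ij.
by rewrite !mxE HL ?(ltnW ij) // subr0 -val_eqE (ltn_eqF ij).
Qed.

(* By switching_eq_exists_unique, z ranges over exactly one vector for each x. *)
Definition abs_normal_form (R : realType) (n m s : nat)
    (f : 'cV[R]_n -> 'cV[R]_m) (c : 'cV[R]_s) (b : 'cV[R]_m)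
    (Z : 'M[R]_(s, n)) (L : 'M[R]_s) (J : 'M[R]_(m, n)) (Y : 'M[R]_(m, s))
    : Prop :=
  strictly_lower L /\
  forall x z, switching_eq c Z L x z -> f x = b + J *m x + Y *m absv z.

(* strictly_lower_unitmx ensures that invmx below is a genuine inverse. *)
Definition Ltilde (R : realType) (s : nat) (L : 'M[R]_s) : 'M[R]_s :=
  invmx (1%:M - L) *m (1%:M + L).

Definition Ytilde (R : realType) (m s : nat) (L : 'M[R]_s)
    (Y : 'M[R]_(m, s)) : 'M[R]_(m, s) :=
  Y *m (1%:M + Ltilde L).

Definition Ztilde (R : realType) (n s : nat) (L : 'M[R]_s)
    (Z : 'M[R]_(s, n)) : 'M[R]_(s, n) :=
  invmx (1%:M - L) *m Z.

Definition Jtilde (R : realType) (n m s : nat) (Z : 'M[R]_(s, n))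
    (L : 'M[R]_s) (J : 'M[R]_(m, n)) (Y : 'M[R]_(m, s)) : 'M[R]_(m, n) :=
  J + Y *m Ztilde L Z.

(* 0 <= p _|_ q >= 0 *)
Definition complementary (R : realType) (s : nat) (p q : 'cV[R]_s) : Prop :=
  [/\ forall i, 0 <= p i 0, forall i, 0 <= q i 0 & p^T *m q = 0].

Definition mlcp_solution (R : realType) (n s : nat) (Z : 'M[R]_(s, n))
    (L : 'M[R]_s) (J : 'M[R]_(1, n)) (Y : 'M[R]_(1, s))
    (xi : 'cV[R]_n) (omega : 'cV[R]_s) : Prop :=
  0 = 1%:M + Jtilde Z L J Y *m xi + Ytilde L Y *m omega /\
  complementary omega (Ztilde L Z *m xi + Ltilde L *m omega).

(* Main.v *)
(** Replacing the constant [c] by [0] in the switching equation and dropping [b]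
    gives the positively homogeneous recession function of [f], which stays
    within a bounded distance of [f].  Splitting [z] into positive and negative
    parts turns the mixed complementarity problem into the statement that the
    recession function takes the value [-1].  If it does, [f] is unbounded below
    along a ray.  If it does not, the recession function is nonnegative, so [f]
    is bounded below; fixing the signs of [z] splits [R^n] into finitely many
    polyhedra on which [f] is affine, and an affine function bounded below on a
    nonempty polyhedron attains its minimum there (by Fourier-Motzkin
    elimination its set of values is given by finitely many non-strict linear
    inequalities in one variable). *)
Require Import Defs.
From mathcomp Require Import all_boot all_order all_algebra.
From mathcomp Require Import all_classical reals topology normedtype.
From mathcomp Require Import ring lra.
Set Implicit Arguments.
Unset Strict Implicit.
Unset Printing Implicit Defensive.
Import Order.TTheory GRing.Theory Num.Theory numFieldNormedType.Exports.
Local Open Scope ring_scope.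

(** * Fourier-Motzkin elimination *)

(** Rows with [a i > 0] bound [t] from below by [- g i / a i], rows with [a j < 0] from above by
    [g j / - a j]; the last condition compares each lower bound with each upper one. *)
Lemma fourier_motzkin1 (R : realFieldType) (I : finType) (a g : I -> R) :
  (exists t, forall i, 0 <= g i + a i * t) <->
  (forall i, a i = 0 -> 0 <= g i) /\
  (forall i j, 0 < a i -> a j < 0 -> 0 <= a i * g j - a j * g i).
Proof.
split=> [[t gt]|[g0 gg]].
  split=> [i ai|i j ai aj]; first by have := gt i; rewrite ai mul0r addr0.
  have -> : a i * g j - a j * g i
    = a i * (g j + a j * t) + (- a j) * (g i + a i * t) by ring.
  by rewrite addr_ge0 // mulr_ge0 // ?oppr_ge0 ltW.
(* The witness is the largest lower bound, failing that the smallest upper bound, failing both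
   [0]. *)
have [i0 ai0|npos] := pickP (fun i => 0 < a i).
  case: (@arg_maxP _ _ _ i0 (fun i => 0 < a i) (fun i => - g i / a i) ai0).
  move=> i ai imax; exists (- g i / a i) => j.
  case: (ltrgt0P (a j)) => aj.
  - have /= := imax j aj; rewrite ler_pdivrMr // => ji.
    by rewrite (mulrC (a j)) -lerBlDl sub0r.
  - have -> : g j + a j * (- g i / a i) = (a i * g j - a j * g i) / a i.
      by field; rewrite gt_eqF.
    by rewrite divr_ge0 ?gg // ltW.
  - by rewrite aj mul0r addr0 g0.
have [j0 aj0|nneg] := pickP (fun j => a j < 0).
  case: (@arg_minP _ _ _ j0 (fun i => a i < 0) (fun i => g i / - a i) aj0).
  move=> i ai imin; exists (g i / - a i) => j.
  case: (ltrgt0P (a j)) => aj; first by move: (npos j); rewrite /= aj.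
  - have := imin j aj; rewrite ler_pdivlMr ?oppr_gt0 // => ji.
    by rewrite (mulrC (a j)) -lerBlDr sub0r -mulrN.
  - by rewrite aj mul0r addr0 g0.
exists 0 => i; rewrite mulr0 addr0; apply: g0.
by apply/eqP; rewrite eq_le !leNgt npos nneg.
Qed.

(** The coordinates of [x] are eliminated one at a time, while [t] is carried along as a parameter
    so that the final system does not depend on it. *)
Lemma fourier_motzkin (R : realFieldType) (n : nat) (I : finType)
    (a : I -> 'rV[R]_n) (al be : I -> R) :
  exists (K : finType) (al' be' : K -> R), forall t,
    (exists x : 'cV_n, forall i, 0 <= (a i *m x) 0 0 + al i * t + be i) <->
    (forall k, 0 <= al' k * t + be' k).
Proof.
elim: n I a al be => [|n IHn] I a al be.
  exists I, al, be => t; split=> [[x xP] i|tP].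
    by have := xP i; rewrite [a i]thinmx0 mul0mx mxE add0r.
  by exists 0 => i; rewrite mulmx0 mxE add0r.
pose h i := a i 0 0; pose r i : 'rV_n := @rsubmx _ _ 1 n (a i).
pose pos (p : I * I) := (0 < h p.1) && (h p.2 < 0).
(* Rows free of the first coordinate are kept, rows of opposite sign are combined, and every other
   index gets the trivial row [0 <= 0]. Being generic in [T], [cb] serves both row vectors and
   scalars. *)
pose cb (T : zmodType) (m : R -> T -> T) (F : I -> T) (k : I + I * I) : T :=
  match k with
  | inl i => if h i == 0 then F i else 0
  | inr p => if pos p then m (h p.1) (F p.2) - m (h p.2) (F p.1) else 0
  end.
have [K [al' [be' KP]]] :=
  IHn _ (cb _ (fun u v => u *: v) r) (cb _ *%R al) (cb _ *%R be).
exists K, al', be' => t; rewrite -KP {KP}.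
pose g (x : 'cV_n) i := (r i *m x) 0 0 + al i * t + be i.
have cbE x k : (cb _ (fun u v => u *: v) r k *m x) 0 0
    + cb _ *%R al k * t + cb _ *%R be k = cb _ *%R (g x) k.
  case: k => [i|[i j]] /=; rewrite /g.
    by case: ifP => // _; rewrite mul0mx mxE mul0r !addr0.
  case: ifP => _; last by rewrite mul0mx mxE mul0r !addr0.
  by rewrite mulmxBl -!scalemxAl !mxE; ring.
have aE x i s : (a i *m col_mx (s%:M : 'cV_1) x) 0 0 + al i * t + be i
    = g x i + h i * s.
  rewrite -[a i](@hsubmxK _ _ 1 n) (@mul_row_col _ _ 1 n) mxE /g -/(r i).
  rewrite mul_mx_scalar !mxE (_ : lshift n 0 = 0); last exact/val_inj.
  by rewrite /h; ring.
split=> [[x xP]|[x xP]].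
  have [g0 gg] : (forall i, h i = 0 -> 0 <= g (@dsubmx _ 1 n _ x) i) /\
      (forall i j, 0 < h i -> h j < 0 ->
         0 <= h i * g (@dsubmx _ 1 n _ x) j - h j * g (@dsubmx _ 1 n _ x) i).
    apply/fourier_motzkin1; exists (x 0 0) => i; rewrite -aE.
    have x0E : (x 0 0)%:M = @usubmx _ 1 n 1 x.
      apply/matrixP => u v; rewrite !ord1 !mxE mulr1n; congr (x _ _).
      exact/val_inj.
    by rewrite x0E vsubmxK.
  exists (@dsubmx _ 1 n _ x) => k; rewrite cbE; case: k => [i|[i j]] /=.
    by case: eqP => // /g0.
  by case: ifP => // /andP[/= hi hj]; apply: gg.
have [s sP] : exists s, forall i, 0 <= g x i + h i * s.
  apply/fourier_motzkin1; split=> [i hi|i j hi hj].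
    by have := xP (inl i); rewrite cbE /= hi eqxx.
  by have := xP (inr (i, j)); rewrite cbE /= /pos /= hi hj.
by exists (col_mx (s%:M : 'cV_1) x) => i; rewrite aE.
Qed.

(** * Attainment of minima on polyhedra *)

Definition polyhedron (R : realFieldType) (m n : nat) (A : 'M[R]_(m, n))
    (d : 'cV[R]_m) (x : 'cV[R]_n) : Prop :=
  forall i, 0 <= (A *m x + d) i 0.

Lemma linear_program_attained (R : realType) (m n : nat) (A : 'M[R]_(m, n))
    (d : 'cV[R]_m) (p : 'rV[R]_n) (q M : R) (x0 : 'cV[R]_n) :
  polyhedron A d x0 ->
  (forall x, polyhedron A d x -> M <= (p *m x) 0 0 + q) ->
  exists2 x, polyhedron A d x &
    forall y, polyhedron A d y -> (p *m x) 0 0 <= (p *m y) 0 0.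
Proof.
move=> Px0 PM.
(* The two [inr] rows, of opposite signs, encode the equation [t = p x + q]. *)
pose a (i : 'I_m + bool) : 'rV_n :=
  match i with inl i => row i A | inr e => (-1) ^+ e *: p end.
pose al (i : 'I_m + bool) : R :=
  match i with inl i => 0 | inr e => - (-1) ^+ e end.
pose be (i : 'I_m + bool) : R :=
  match i with inl i => d i 0 | inr e => (-1) ^+ e * q end.
have [K [al' [be' KP]]] := fourier_motzkin a al be.
pose S : set R := [set t | exists2 x, polyhedron A d x & (p *m x) 0 0 + q = t]%classic.
have SP t : S t <-> (forall k, 0 <= al' k * t + be' k).
  rewrite -KP; split=> [[x Px <-]|[x xP]]; exists x.
  - case=> [i|e] /=; first by rewrite -row_mul mul0r addr0; have := Px i; rewrite !mxE.
    rewrite -scalemxAl mxE.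
    by rewrite [leRHS](_ : _ = 0) //; ring.
  - by move=> i; have := xP (inl i); rewrite /= -row_mul mul0r addr0 !mxE.
  - have := xP (inr true); have := xP (inr false) => /=.
    by rewrite -!scalemxAl expr0 expr1 !mxE /=; lra.
have S0 : (S !=set0)%classic by exists ((p *m x0) 0 0 + q), x0.
have Slb : has_lbound S by exists M => _ [x Px <-]; apply: PM.
have infS t : S t -> inf S <= t by move=> St; apply: ge_inf.
have [x Px xE] : S (inf S).
  (* A row with [al' k <= 0] passes from any point of [S] down to [inf S]; one with [al' k > 0] is a
     lower bound of [S], hence of [inf S]. *)
  apply/SP => k; case: (lerP (al' k) 0) => ak.
    have [t St] := S0; have /SP/(_ k) := St.
    by move=> /le_trans; apply; rewrite lerD2r ler_wnM2l // infS.
  rewrite -lerBlDr sub0r mulrC -ler_pdivrMr //; apply: lb_le_inf => // t /SP/(_ k).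
  by rewrite ler_pdivrMr // mulrC -lerBlDr sub0r.
by exists x => // y Py; rewrite -(lerD2r q) xE infS //; exists y.
Qed.

Lemma piecewise_linear_program_attained (R : realType) (n m : nat) (K : finType)
    (A : K -> 'M[R]_(m, n)) (d : K -> 'cV[R]_m) (p : K -> 'rV[R]_n) (q : K -> R)
    (f : 'cV[R]_n -> R) (M : R) :
  (forall x, exists k, polyhedron (A k) (d k) x) ->
  (forall k x, polyhedron (A k) (d k) x -> f x = (p k *m x) 0 0 + q k) ->
  (forall x, M <= f x) ->
  exists x0, is_global_min f x0.
Proof.
move=> cover fE fM.
(* [g k] minimizes [f] on piece [k]; on an empty piece it is an arbitrary point, excluded from the
   comparison below. *)
have /choice[g gP] k : exists x, (exists y, polyhedron (A k) (d k) y) ->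
    polyhedron (A k) (d k) x /\
    forall y, polyhedron (A k) (d k) y -> f x <= f y.
  have [[y Py]|nP] := pselect (exists y, polyhedron (A k) (d k) y); last by exists 0.
  have [|x Px xmin] := linear_program_attained (p := p k) (q := q k) (M := M) Py.
    by move=> x Px; rewrite -fE.
  exists x => _; split=> // u Pu.
  by rewrite (fE _ _ Px) (fE _ _ Pu) lerD2r xmin.
have [k0 Pk0] := cover 0.
have k0P : `[< exists y, polyhedron (A k0) (d k0) y >] by apply/asboolP; exists 0.
case: (@arg_minP _ _ _ k0 (fun k => `[< exists y, polyhedron (A k) (d k) y >])
  (f \o g) k0P) => k _ kmin.
exists (g k) => x; have [j Pj] := cover x.
have neP : exists y, polyhedron (A j) (d j) y by exists x.
apply: le_trans (kmin j _) _; first exact/asboolP.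
by have [_] := gP _ neP; apply.
Qed.

(** * Distance to the recession function *)

Lemma switching_eqE (R : realType) (n s : nat) (c : 'cV[R]_s)
    (Z : 'M[R]_(s, n)) (L : 'M[R]_s) (x : 'cV[R]_n) (z : 'cV[R]_s) i :
  switching_eq c Z L x z ->
  z i 0 = c i 0 + (Z *m x) i 0 + \sum_j L i j * `|z j 0|.
Proof.
move=> /(congr1 (fun u : 'cV_s => u i 0)) ->; rewrite !mxE.
by congr (_ + _); apply: eq_bigr => j _; rewrite mxE.
Qed.

(** The term [Z x] cancels in [z - z'], and row [i] of [L] only sees earlier entries, so a bound
    uniform in [x] follows by induction on the number of entries. *)
Lemma switching_dist_bounded (R : realType) (n s : nat) (c : 'cV[R]_s)
    (Z : 'M[R]_(s, n)) (L : 'M[R]_s) :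
  strictly_lower L ->
  exists C, forall x z z', switching_eq c Z L x z -> switching_eq 0 Z L x z' ->
    forall i, `|z i 0 - z' i 0| <= C.
Proof.
move=> HL.
suff bnd k : exists2 C, 0 <= C & forall x z z', switching_eq c Z L x z ->
    switching_eq 0 Z L x z' -> forall i : 'I_s, (i < k)%N -> `|z i 0 - z' i 0| <= C.
  by have [C _ CP] := bnd s; exists C => x z z' zP z'P i; apply: (CP x).
elim: k => [|k [C C0 CP]]; first by exists 0.
pose B := \sum_i (`|c i 0| + \sum_j `|L i j| * C).
have term0 i : 0 <= `|c i 0| + \sum_j `|L i j| * C.
  by rewrite addr_ge0 // sumr_ge0 // => j _; rewrite mulr_ge0.
exists B => [|x z z' zP z'P i ik]; first exact: sumr_ge0.
apply: (@le_trans _ _ (`|c i 0| + \sum_j `|L i j| * C)); last first.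
  by rewrite /B [leRHS](bigD1 i) //= lerDl sumr_ge0.
rewrite (switching_eqE i zP) (switching_eqE i z'P).
rewrite [(0 : 'cV[R]_s) i 0]mxE add0r.
rewrite [X in `|X|](_ : _ = c i 0 + \sum_j L i j * (`|z j 0| - `|z' j 0|)); last first.
  under [in RHS]eq_bigr => j _ do rewrite mulrBr.
  by rewrite sumrB; ring.
apply: le_trans (ler_normD _ _) _; rewrite lerD2l.
apply: le_trans (ler_norm_sum _ _ _) _; apply: ler_sum => j _.
rewrite normrM; case: (leqP i j) => ij; first by rewrite HL // normr0 !mul0r.
rewrite ler_wpM2l //; apply: le_trans (ler_dist_dist _ _) _.
by apply: (CP x) => //; apply: leq_trans ij _.
Qed.

Lemma recession_dist_bounded (R : realType) (n s : nat) (f : 'cV[R]_n -> R)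
    (c : 'cV[R]_s) (b : 'cV[R]_1) (Z : 'M[R]_(s, n)) (L : 'M[R]_s)
    (J : 'M[R]_(1, n)) (Y : 'M[R]_(1, s)) :
  abs_normal_form (fun x => (f x)%:M : 'cV[R]_1) c b Z L J Y ->
  exists C, forall x z, switching_eq 0 Z L x z ->
    `|f x - (J *m x + Y *m absv z) 0 0| <= C.
Proof.
move=> [HL fP]; have [C CP] := switching_dist_bounded c Z HL.
exists (`|b 0 0| + \sum_j `|Y 0 j| * C) => x z' z'P.
have [z [zP _]] := switching_eq_exists_unique c Z x HL.
have /matrixP/(_ 0 0) := fP x z zP; rewrite mxE mulr1n => ->.
rewrite [X in `|X|](_ : _ = b 0 0 + \sum_j Y 0 j * (`|z j 0| - `|z' j 0|)); last first.
  under [in RHS]eq_bigr => j _ do rewrite mulrBr.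
  rewrite sumrB !mxE.
  under [X in _ + X - _]eq_bigr => j _ do rewrite mxE.
  under [X in _ - (_ + X)]eq_bigr => j _ do rewrite mxE.
  by ring.
apply: le_trans (ler_normD _ _) _; rewrite lerD2l.
apply: le_trans (ler_norm_sum _ _ _) _; apply: ler_sum => j _.
rewrite normrM ler_wpM2l //; apply: le_trans (ler_dist_dist _ _) _.
exact: (CP x).
Qed.

Lemma absv_scale (R : realType) (s : nat) (z : 'cV[R]_s) (t : R) :
  0 <= t -> absv (t *: z) = t *: absv z.
Proof. by move=> t0; apply/colP => i; rewrite !mxE normrM ger0_norm. Qed.

Lemma switching_eq_scale (R : realType) (n s : nat) (Z : 'M[R]_(s, n))
    (L : 'M[R]_s) (x : 'cV[R]_n) (z : 'cV[R]_s) (t : R) :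
  0 <= t -> switching_eq 0 Z L x z -> switching_eq 0 Z L (t *: x) (t *: z).
Proof.
move=> t0 zP; rewrite /switching_eq absv_scale //.
by rewrite add0r -!scalemxAr -scalerDr {1}zP add0r.
Qed.

(* The complementary pair [(omega, w)] consists of the negative and positive
   parts of [z]: [z = w - omega] and [|z| = w + omega]. *)
Lemma mlcp_solvableP (R : realType) (n s : nat) (Z : 'M[R]_(s, n)) (L : 'M[R]_s)
    (J : 'M[R]_(1, n)) (Y : 'M[R]_(1, s)) :
  strictly_lower L ->
  (exists xi omega, mlcp_solution Z L J Y xi omega) <->
  (exists xi z, switching_eq 0 Z L xi z /\ J *m xi + Y *m absv z = - 1%:M).
Proof.
move=> HL; have U := strictly_lower_unitmx HL.
(* Since [w + om] stands for [|z|], this turns the tilde form of the objective into the recession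
   function. *)
have objE (xi : 'cV_n) (om w : 'cV_s) : w = Ztilde L Z *m xi + Ltilde L *m om ->
    Jtilde Z L J Y *m xi + Ytilde L Y *m om = J *m xi + Y *m (w + om).
  move=> ->; rewrite /Jtilde /Ytilde !(mulmxDl, mulmxDr) mulmx1 -!mulmxA.
  by rewrite -!addrA; congr (_ + (_ + _)); rewrite addrC.
split=> [[xi [om [obj]]]|[xi [z [zP obj]]]].
  move wE: (Ztilde L Z *m xi + _) => w [om0 w0 omw].
  have omw0 : \sum_i om i 0 * w i 0 = 0.
    transitivity ((om^T *m w) 0 0); last by rewrite omw mxE.
    by rewrite [RHS]mxE; apply: eq_bigr => i _; rewrite [om^T _ _]mxE.
  have omwi i : om i 0 * w i 0 = 0.
    by apply: (psumr_eq0P _ omw0) => // j _; rewrite mulr_ge0.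
  have zE : absv (w - om) = w + om.
    apply/colP => i; rewrite !mxE.
    have /eqP := omwi i; rewrite mulf_eq0 => /orP[] /eqP ->.
      by rewrite subr0 addr0 ger0_norm.
    by rewrite sub0r add0r normrN ger0_norm.
  exists xi, (w - om); rewrite /switching_eq zE; split.
    (* Rearranged, this is [w - om = Z xi + L (w + om)], the switching equation. *)
    have : (1%:M - L) *m w = Z *m xi + (1%:M + L) *m om.
      by rewrite -wE /Ztilde /Ltilde mulmxDr -!mulmxA !mulKVmx.
    rewrite mulmxBl mulmxDl !mul1mx add0r mulmxDr => /eqP.
    rewrite subr_eq => /eqP {1}->.
    by rewrite -!addrA; congr (_ + _); rewrite addrC -!addrA addNr addr0 addrC.
  apply/eqP; rewrite -addr_eq0 addrC; apply/eqP; rewrite [RHS]obj -addrA.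
  by congr (_ + _); rewrite (objE xi om w).
pose w : 'cV_s := 2^-1 *: (absv z + z); pose om : 'cV_s := 2^-1 *: (absv z - z).
have two (u : 'cV[R]_s) : 2^-1 *: u + 2^-1 *: u = u.
  by rewrite -scalerDl (_ : 2^-1 + 2^-1 = 1 :> R) ?scale1r //; field.
have wDom : w + om = absv z.
  by rewrite /w /om -scalerDr addrACA subrr addr0 scalerDr two.
have wBom : w - om = z.
  by rewrite /w /om -scalerBr opprB addrC addrA subrK scalerDr two.
have wE : w = Ztilde L Z *m xi + Ltilde L *m om.
  rewrite /Ztilde /Ltilde -!mulmxA.
  apply: (can_inj (mulKmx U)); rewrite mulmxDr !mulKVmx //.
  rewrite mulmxBl mulmxDl !mul1mx; apply/eqP; rewrite subr_eq -!addrA.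
  rewrite -mulmxDr [om + w]addrC wDom [om + _]addrC addrA -subr_eq wBom.
  by rewrite {1}zP add0r.
exists xi, om; split; first by rewrite -addrA (objE _ _ w) // wDom obj subrr.
rewrite -wE; split=> [i|i|].
- by rewrite !mxE; have := ler_norm (z i 0); lra.
- by rewrite !mxE; have := ler_norm (- z i 0); rewrite normrN; lra.
(* Each product of entries is a multiple of [|z k|^2 - (z k)^2 = 0]. *)
apply/matrixP => i j; rewrite !ord1 !mxE big1 // => k _; rewrite !mxE.
by rewrite mulrACA mulrC -subr_sqr -normrX ger0_norm ?sqr_ge0 // subrr mul0r.
Qed.

(* For the signs [e] of [z], [|z| = E z] with [E] diagonal, so that
   [z = (I - L E)^-1 (c + Z x)]. *)
Lemma bounded_abs_normal_attained (R : realType) (n s : nat) (f : 'cV[R]_n -> R)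
    (c : 'cV[R]_s) (b : 'cV[R]_1) (Z : 'M[R]_(s, n)) (L : 'M[R]_s)
    (J : 'M[R]_(1, n)) (Y : 'M[R]_(1, s)) (M : R) :
  abs_normal_form (fun x => (f x)%:M : 'cV[R]_1) c b Z L J Y ->
  (forall x, M <= f x) -> exists x0, is_global_min f x0.
Proof.
move=> [HL fP] fM.
pose E (e : {ffun 'I_s -> bool}) : 'M[R]_s := diag_mx (\row_i (-1) ^+ e i).
have EE e (z : 'cV[R]_s) i : (E e *m z) i 0 = (-1) ^+ e i * z i 0.
  by rewrite /E mul_diag_mx !mxE.
pose V e := invmx (1%:M - L *m E e).
have U e : 1%:M - L *m E e \in unitmx.
  apply: strictly_lower_unitmx => i j ij.
  by rewrite /E mul_mx_diag !mxE HL // mul0r.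
(* The inequalities of piece [e] say [E z >= 0] for [z = V (c + Z x)]. They are non-strict, so zero
   entries of [z] are allowed either sign. *)
apply: (@piecewise_linear_program_attained _ _ s _
  (fun e => E e *m V e *m Z) (fun e => E e *m V e *m c)
  (fun e => J + Y *m E e *m V e *m Z)
  (fun e => (b + Y *m E e *m V e *m c) 0 0) f M) => //.
  move=> x; have [z [zP _]] := switching_eq_exists_unique c Z x HL.
  exists [ffun i => z i 0 < 0] => i; set e := finfun _.
  have Ez : E e *m z = absv z.
    apply/colP => k; rewrite EE ffunE mxE.
    by case: (ltP (z k 0) 0) => zk;
      [rewrite expr1 mulN1r ltr0_norm | rewrite mul1r ger0_norm].
  have -> : E e *m V e *m Z *m x + E e *m V e *m c = absv z.
    rewrite -!mulmxA -!mulmxDr -Ez; congr (_ *m _).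
    apply: (can_inj (mulKmx (U e))); rewrite mulKVmx // mulmxBl mul1mx -mulmxA Ez.
    by rewrite {1}zP addrK addrC.
  by rewrite mxE.
move=> e x Px.
pose z := V e *m (c + Z *m x).
have zE : E e *m z = E e *m V e *m Z *m x + E e *m V e *m c.
  by rewrite /z mulmxA mulmxDr addrC !mulmxA.
(* [E z] is nonnegative and its entries have the absolute values of those of [z]. *)
have Ez : E e *m z = absv z.
  apply/colP => i; have := Px i; rewrite -zE !EE [absv z _ _]mxE => ez0.
  by rewrite -[LHS]ger0_norm // normrM normrX normrN1 expr1n mul1r.
have zP : switching_eq c Z L x z.
  have := mulKVmx (U e) (c + Z *m x).
  by rewrite -/(V e) -/z mulmxBl mul1mx -mulmxA Ez => /eqP; rewrite subr_eq => /eqP.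
have /matrixP/(_ 0 0) := fP x z zP; rewrite [LHS]mxE mulr1n => ->.
rewrite [X in fun_of_matrix X](_ : _ = (J + Y *m E e *m V e *m Z) *m x
  + (b + Y *m E e *m V e *m c)); first by rewrite mxE.
rewrite -Ez zE mulmxDr mulmxDl !mulmxA [RHS]addrACA.
by congr (_ + _); exact: addrC.
Qed.

(* f is real-valued; (f x)%:M is its value seen as a vector of R^1. *)
Theorem corollary4p2 (R : realType) (n s : nat) (f : 'cV[R]_n -> R)
    (c : 'cV[R]_s) (b : 'cV[R]_1) (Z : 'M[R]_(s, n)) (L : 'M[R]_s)
    (J : 'M[R]_(1, n)) (Y : 'M[R]_(1, s)) :
  piecewise_affine (fun x => (f x)%:M : 'cV[R]_1) ->
  abs_normal_form (fun x => (f x)%:M : 'cV[R]_1) c b Z L J Y ->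
  (exists x0, is_global_min f x0) <->
  ~ (exists (xi : 'cV[R]_n) (omega : 'cV[R]_s),
       mlcp_solution Z L J Y xi omega).
Proof.
move=> _ fP; have HL := fP.1; rewrite mlcp_solvableP //.
have [C CP] := recession_dist_bounded fP.
have scaleE (xi : 'cV[R]_n) (z : 'cV[R]_s) t : 0 <= t ->
    J *m (t *: xi) + Y *m absv (t *: z) = t *: (J *m xi + Y *m absv z).
  by move=> t0; rewrite absv_scale // -!scalemxAr -scalerDr.
split=> [[x0 x0min] [xi [z [zP zE]]]|nsol].
  have C0 : 0 <= C by apply: le_trans (CP _ _ zP).
  (* At [t *: xi] the recession function is [- t], so [f] is at most [C - t = - |f x0| - 1], below
     [f x0]. *)
  pose t := C + `|f x0| + 1.
  have t0 : 0 <= t by rewrite !addr_ge0.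
  have := CP _ _ (switching_eq_scale t0 zP).
  rewrite scaleE // zE !mxE mulr1n => /(le_trans (ler_norm _)).
  have := x0min (t *: xi); have := ler_norm (- f x0); rewrite normrN /t; lra.
apply: (bounded_abs_normal_attained (M := - C) fP) => x.
have [z [zP _]] := switching_eq_exists_unique 0 Z x HL.
have fx := CP _ _ zP; set g := (X in `|f x - X|) in fx.
suff g0 : 0 <= g by move: fx; rewrite ler_norml => /andP[]; lra.
rewrite leNgt; apply/negP => g0; apply: nsol.
(* By positive homogeneity, scaling by [- g^-1] turns the negative value [g] into [-1]. *)
have t0 : 0 <= - g^-1 by rewrite oppr_ge0 invr_le0 ltW.
exists (- g^-1 *: x), (- g^-1 *: z); split; first exact: switching_eq_scale.
rewrite scaleE //; apply/matrixP => i j; rewrite !ord1 mxE -/g !mxE mulr1n.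
by rewrite mulNr mulVf // lt_eqF.
Qed.
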